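(* Let $s=1$ and let $r\ge3$ be an integer. Let $G=\overline{\langle a_1,\dots,a_r\rangle}\subset W$ be the closed subgroup topologically generated by the elements $a_1,\dots,a_r\in W$ determined by $a_1=\sigma$, $a_2=(a_1,a_r)$, and $a_i=(a_{i-1},1)$ for $3\le i\le r$, and let $N:=\operatorname{Norm}_W(G)$. Define $w_1:=(1,(a_1a_r)^2)$ and $w_{i+1}:=(w_i,w_i)$ for all $i\ge1$. These elements lie in $N$, have order two and converge to $1$, and the map $$\varphi:\prod_{i=1}^\infty\mathbb{F}_2\to N,\qquad (k_1,k_2,\dots)\mapsto w_1^{k_1}w_2^{k_2}\cdots$$ (limit of the finite products) is well-defined. Then $\varphi$ induces an isomorphism of groups $$\bar\varphi:\prod_{i=1}^\infty\mathbb{F}_2\ \xrightarrow{\ \sim\ }\ N/G.$$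
   Context: $T$ is the infinite rooted binary tree whose vertices are the finite words over $\{0,1\}$, with root the empty word, each word $t$ being joined by an edge to $t0$ and $t1$. $W:=\operatorname{Aut}(T)$ is its automorphism group, a profinite group as the inverse limit of the finite groups $W_n=\operatorname{Aut}(T_n)$, where $T_n\subset T$ is the subtree of words of length $\le n$. For $u,v\in W$, $(u,v)\in W$ denotes the automorphism $0t\mapsto 0\,u(t)$, $1t\mapsto 1\,v(t)$ for all words $t$; $\sigma\in W$ is the automorphism of order $2$ with $0t\mapsto 1t$ and $1t\mapsto 0t$. Thus $W=(W\times W)\rtimes\langle\sigma\rangle$. The recursion relations for $a_1,\dots,a_r$ have a unique solution in $W$. $\operatorname{Norm}_W(G)$ is the normalizer of $G$ in $W$. The map $\bar\varphi$ is the composite of $\varphi$ with the projection $N\to N/G$ ($\varphi$ itself is not a homomorphism). *)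

(* Defs.v *)
From HB Require Import structures.
From mathcomp Require Import all_boot all_order all_fingroup all_algebra.
From mathcomp Require Import all_classical topology.

Set Implicit Arguments.
Unset Strict Implicit.
Unset Printing Implicit Defensive.

Local Open Scope classical_set_scope.
Local Open Scope group_scope.

(* A vertex is a finite word; the letter 0 is false and the letter 1 is true. *)
Definition word := seq bool.

Definition child (s t : word) : bool :=
  (t == rcons s false) || (t == rcons s true).

Definition edge (s t : word) : bool := child s t || child t s.

Definition is_tree_aut (f : word -> word) : Prop :=
  [/\ bijective f, f [::] = [::] & forall s t, edge (f s) (f t) = edge s t].

Record treeAut := TreeAut { aut_fun :> word -> word ; autP : is_tree_aut aut_fun }.

Lemma treeAut_ext (g h : treeAut) : (forall s, g s = h s) -> g = h.
Proof.
case: g h => [f fP] [f' f'P] /= /funext eqf.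
by case: _ / eqf in f'P *; congr TreeAut; exact: Prop_irrelevance.
Qed.

Section GroupStructure.

Fact aut_one_subproof : is_tree_aut id.
Proof. by split=> //; exists id. Qed.

Definition aut_one : treeAut := TreeAut aut_one_subproof.

Fact aut_mul_subproof (g h : treeAut) : is_tree_aut (g \o h).
Proof.
case: g h => [g [gb g0 ge]] [h [hb h0 he]]; split=> /=.
- exact: bij_comp.
- by rewrite h0.
- by move=> s t; rewrite ge he.
Qed.

(* Automorphisms act on the left: (g * h)(t) = g (h t). *)
Definition aut_mul (g h : treeAut) : treeAut := TreeAut (aut_mul_subproof g h).

Fact aut_inv_exists (g : treeAut) : exists h : treeAut, cancel g h /\ cancel h g.
Proof.
case: g => [g [[h gh hg] g0 ge]].
have hP : is_tree_aut h.
  split; first by exists g.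
    by rewrite -g0 gh.
  by move=> s t; rewrite -[in RHS](hg s) -[in RHS](hg t) ge.
by exists (TreeAut hP).
Qed.

Definition aut_inv (g : treeAut) : treeAut := sval (cid (aut_inv_exists g)).

Lemma aut_invK (g : treeAut) : cancel g (aut_inv g) /\ cancel (aut_inv g) g.
Proof. exact: svalP (cid (aut_inv_exists g)). Qed.

HB.instance Definition _ := gen_eqMixin treeAut.
HB.instance Definition _ := gen_choiceMixin treeAut.

Fact aut_mulA : associative aut_mul.
Proof. by move=> f g h; apply: treeAut_ext. Qed.

Fact aut_mul1g : left_id aut_one aut_mul.
Proof. by move=> g; apply: treeAut_ext. Qed.

Fact aut_mulg1 : right_id aut_one aut_mul.
Proof. by move=> g; apply: treeAut_ext. Qed.

Fact aut_mulVg : left_inverse aut_one aut_inv aut_mul.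
Proof. by move=> g; apply: treeAut_ext => s /=; case: (aut_invK g). Qed.

Fact aut_mulgV : right_inverse aut_one aut_inv aut_mul.
Proof. by move=> g; apply: treeAut_ext => s /=; case: (aut_invK g). Qed.

HB.instance Definition _ := isGroup.Build treeAut
  aut_mulA aut_mul1g aut_mulg1 aut_mulVg aut_mulgV.

End GroupStructure.

Section Topology.

(* The fibre through g of the restriction map from Aut(T) to the discrete finite
   group Aut(T_n), where T_n consists of the words of length at most n; these
   fibres form a base of the inverse limit topology. *)
Definition cylinder (g : treeAut) (n : nat) : set treeAut :=
  [set h | forall s : word, size s <= n -> h s = g s].

HB.instance Definition _ := isPointed.Build treeAut (1 : treeAut).

HB.instance Definition _ :=
  hasNbhs.Build treeAut (fun g => filter_from setT (cylinder g)).

Fact treeAut_nbhs_filter (g : treeAut) : ProperFilter (nbhs g).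
Proof.
apply: filter_from_proper; last by move=> n _; exists g.
apply: filter_from_filter; first by exists 0%N.
move=> m n _ _; exists (maxn m n) => // h hg; split=> s ls; apply: hg.
  by rewrite (leq_trans ls) ?leq_maxl.
by rewrite (leq_trans ls) ?leq_maxr.
Qed.

Fact treeAut_nbhs_singleton (g : treeAut) (A : set treeAut) : nbhs g A -> A g.
Proof. by move=> [n _]; apply. Qed.

Fact treeAut_nbhs_nbhs (g : treeAut) (A : set treeAut) :
  nbhs g A -> nbhs g (nbhs^~ A).
Proof.
move=> [n _ nA]; exists n => // h hg; exists n => // f fh.
by apply: nA => s ls; rewrite fh ?hg.
Qed.

HB.instance Definition _ := Nbhs_isNbhsTopological.Build treeAut
  treeAut_nbhs_filter treeAut_nbhs_singleton treeAut_nbhs_nbhs.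

Lemma treeAut_hausdorff : hausdorff_space treeAut.
Proof.
move=> g h gh; apply: treeAut_ext => s.
have nb (f : treeAut) : nbhs f (cylinder f (size s)) by exists (size s).
by have [f [/(_ s (leqnn _)) <- /(_ s (leqnn _)) <-]] := gh _ _ (nb g) (nb h).
Qed.

Lemma treeAut_rcons (g : treeAut) s b : exists c, g (rcons s b) = rcons (g s) c.
Proof.
have [[g' gK _] g0 ge] := autP g; have ginj := can_inj gK.
have edge_rcons t c : edge t (rcons t c).
  by rewrite /edge /child; case: c; rewrite eqxx ?orbT.
elim/last_ind: s b => [|s c IH] b.
  have := edge_rcons [::] b; rewrite -ge g0 /edge => /orP[/orP[]/eqP->|].
  - by exists false.
  - by exists true.
  - by rewrite /child => /orP[] /eqP /(congr1 size); rewrite size_rcons.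
have := edge_rcons (rcons s c) b; rewrite -ge /edge => /orP[/orP[]/eqP->|].
- by exists false.
- by exists true.
have [d gd] := IH c; rewrite [in X in X -> _]gd.
rewrite /child !eqseq_rcons => /orP[] /andP[/eqP /ginj /(congr1 size)].
all: by rewrite !size_rcons => /eqP; rewrite -addn2 -{1}[size s]addn0 eqn_add2l.
Qed.

Lemma size_treeAut (g : treeAut) s : size (g s) = size s.
Proof.
elim/last_ind: s => [|s b IH]; first by have [_ -> _] := autP g.
by have [c ->] := treeAut_rcons g s b; rewrite !size_rcons IH.
Qed.

End Topology.

Section Sections.

Definition pair_fun (u v : word -> word) (s : word) : word :=
  match s with
  | [::] => [::]
  | false :: t => false :: u t
  | true :: t => true :: v t
  end.

Definition swap_fun (s : word) : word :=
  if s is b :: t then ~~ b :: t else [::].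

Lemma edge_cons b c s t : edge (b :: s) (c :: t) = (b == c) && edge s t.
Proof.
rewrite /edge /child /= !eqseq_cons (eq_sym c b).
by case: (b == c).
Qed.

Lemma edge_nil_cons b s : edge [::] (b :: s) = (s == [::]).
Proof. by rewrite /edge /child; case: b; case: s => [|c [|d s]]. Qed.

Lemma edgeC s t : edge s t = edge t s.
Proof. by rewrite /edge orbC. Qed.

Lemma aut_eq_nil (g : treeAut) s : (g s == [::]) = (s == [::]).
Proof.
case: g => [g [[h gh hg] g0 _]] /=; apply/eqP/eqP => [gs|-> //].
by rewrite -(gh s) gs -g0 gh.
Qed.

Fact pair_aut_subproof (u v : treeAut) : is_tree_aut (pair_fun u v).
Proof.
split=> //.
- exists (pair_fun (aut_inv u) (aut_inv v)) => -[|[] s] //=.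
  + by rewrite (aut_invK v).1.
  + by rewrite (aut_invK u).1.
  + by rewrite (aut_invK v).2.
  + by rewrite (aut_invK u).2.
have [[_ _ ue] [_ _ ve]] := (autP u, autP v).
move=> [|[] s] [|[] t] //=; rewrite ?edge_cons ?ue ?ve //.
all: by rewrite ?[edge (_ :: _) [::]]edgeC ?edge_nil_cons ?aut_eq_nil.
Qed.

Definition pair_aut (u v : treeAut) : treeAut := TreeAut (pair_aut_subproof u v).

Fact swap_aut_subproof : is_tree_aut swap_fun.
Proof.
split=> //.
- by exists swap_fun => -[|[] s].
- move=> [|[] s] [|[] t] //=; rewrite ?edge_cons //.
  all: by rewrite ?[edge (_ :: _) [::]]edgeC ?edge_nil_cons.
Qed.

Definition sigma : treeAut := TreeAut swap_aut_subproof.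

End Sections.

Section Subgroups.
Variable W : groupType.
Implicit Types A B G N : set W.

Definition is_subgroup A : Prop :=
  [/\ A 1, forall x y, A x -> A y -> A (x * y) & forall x, A x -> A x^-1].

Definition subgroup_gen A : set W := smallest is_subgroup A.

Definition Norm G : set W :=
  [set w | [set w * g * w^-1 | g in G] = G].

Definition set_mul A B : set W := [set x * y | x in A & y in B].

Definition lcos x G : set W := [set x * g | g in G].

(* The carrier of N / G; when G is a subgroup and N = Norm G, its
   group law is set_mul, by lcos_mul below. *)
Definition lcos_quotient N G : set (set W) := [set lcos x G | x in N].

Lemma lcos_mul G x y : is_subgroup G -> Norm G y ->
  set_mul (lcos x G) (lcos y G) = lcos (x * y) G.
Proof.
move=> [G1 GM GV] yN; apply/seteqP; split=> z /=.
  move=> [_ [g Gg <-] [_ [h Gh <-] <-]].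
  have : G g by [].
  rewrite -[in X in X -> _]yN => -[g' Gg' eqg].
  exists (g' * h); first exact: GM.
  by rewrite -eqg -!mulgA mulKg.
move=> [g Gg <-].
exists x; first by exists 1 => //; rewrite mulg1.
exists (y * g); last by rewrite mulgA.
by exists g.
Qed.

End Subgroups.

Lemma closure_subgroup (A : set treeAut) :
  is_subgroup A -> is_subgroup (closure A).
Proof.
have clE g : closure A g <-> forall n, exists2 h, A h & cylinder g n h.
  split=> [clg n|clg B [n _ nB]].
    by have [h [Ah gh]] := clg (cylinder g n) (ex_intro2 _ _ n I (fun _ => id)); exists h.
  by have [h Ah gh] := clg n; exists h; split=> //; exact: nB.
move=> [A1 AM AV]; split.
- exact: subset_closure.
- move=> g h /clE clg /clE clh; apply/clE => n.
  have [[g' Ag' gg'] [h' Ah' hh']] := (clg n, clh n).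
  exists (g' * h'); first exact: AM.
  by move=> s sn /=; rewrite hh' // gg' // size_treeAut.
- move=> g /clE clg; apply/clE => n; have [h Ah gh] := clg n.
  exists h^-1; first exact: AV.
  move=> s sn; apply: (can_inj (aut_invK h).1).
  rewrite (aut_invK h).2 gh ?(aut_invK g).2 //.
  by rewrite size_treeAut.
Qed.

Section TheGroup.
Variables (r : nat) (a : nat -> treeAut).

(* Only the values a 1, ..., a r are constrained and used. *)
Definition recursion : Prop :=
  [/\ a 1%N = sigma,
      a 2%N = pair_aut (a 1%N) (a r)
    & forall i, (3 <= i <= r)%N -> a i = pair_aut (a i.-1) 1].

Definition grpG : set treeAut :=
  closure (subgroup_gen [set a i | i in [set i | (1 <= i <= r)%N]]).

Lemma grpG_subgroup : is_subgroup grpG.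
Proof.
apply: closure_subgroup; split.
- by move=> A [[]].
- by move=> x y Ax Ay A AP; have [_ + _] := AP.1; apply; [exact: Ax|exact: Ay].
- by move=> x Ax A AP; have [_ _ +] := AP.1; apply; exact: Ax.
Qed.

(* w i is the element usually written w_(i+1), and likewise the coordinate k i
   below is k_(i+1). *)
Fixpoint w (i : nat) : treeAut :=
  if i is j.+1 then pair_aut (w j) (w j)
  else pair_aut 1 ((a 1%N * a r) ^+ 2).

Definition phi_partial (k : nat -> 'F_2) (n : nat) : treeAut :=
  \prod_(0 <= i < n) w i ^+ k i.

Definition phi (k : nat -> 'F_2) : treeAut := limn (phi_partial k).

Definition phibar (k : nat -> 'F_2) : set treeAut := lcos (phi k) grpG.

End TheGroup.

Section Recursion.
Variables (r : nat).

Fixpoint rec_act (s : word) (i : nat) : word :=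
  match s with
  | [::] => [::]
  | b :: t =>
      if i == 1%N then ~~ b :: t
      else if i == 2%N then b :: rec_act t (if b then r else 1%N)
      else b :: (if b then t else rec_act t i.-1)
  end.

Lemma rec_actK i : involutive (rec_act ^~ i).
Proof.
move=> s; elim: s i => [|b s IH] i //=.
case: eqP => [->|/eqP/negPf i1] /=; first by rewrite negbK.
by case: eqP => [->|/eqP/negPf i2] /=; rewrite ?i1 ?i2 /= ?IH; case: b; rewrite ?IH.
Qed.

Fact rec_act_aut i : is_tree_aut (rec_act ^~ i).
Proof.
split=> //; first by exists (rec_act ^~ i); exact: rec_actK.
have rec_nil s j : (rec_act s j == [::]) = (s == [::]).
  by case: s => [|b s] //=; do 2?case: ifP.
move=> s; elim: s i => [|b s IH] i [|c t] //=.
- by do 2?case: ifP => _; rewrite !edge_nil_cons //; case: c; rewrite ?rec_nil.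
- by do 2?case: ifP => _; rewrite ![edge _ [::]]edgeC !edge_nil_cons //;
    case: b; rewrite ?rec_nil.
- do 2?case: ifP => _; rewrite !edge_cons //; case: b; case: c => //=; exact: IH.
Qed.

Lemma recursion_exists : exists a, recursion r a.
Proof.
exists (fun i => TreeAut (rec_act_aut i)); split.
- by apply: treeAut_ext => -[].
- by apply: treeAut_ext => -[|[] s].
- move=> i /andP[i3 _]; apply: treeAut_ext => -[|b s] //=.
  have /negPf -> : i != 1%N by case: i i3 => [|[|]].
  have /negPf -> : i != 2%N by case: i i3 => [|[|[|]]].
  by case: b.
Qed.

Lemma recursion_unique a b : (2 <= r)%N -> recursion r a -> recursion r b ->
  forall i, (1 <= i <= r)%N -> a i = b i.
Proof.
move=> r2 [a1 a2 a3] [b1 b2 b3] i ir; apply: treeAut_ext => s.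
elim: s i ir => [|c s IH] [|[|[|i]]] // ir.
- by rewrite a1 b1.
- by rewrite a2 b2.
- by rewrite (a3 i.+3 ir) (b3 i.+3 ir).
- by rewrite a1 b1.
- rewrite a2 b2; case: c; congr cons; apply: IH.
  + by rewrite leqnn (ltnW r2).
  + by rewrite (ltnW r2).
- rewrite (a3 i.+3 ir) (b3 i.+3 ir); case: c => //; congr cons; apply: IH.
  by case/andP: ir => _ /ltnW.
Qed.

End Recursion.

(* Main.v *)
(** The finite data [delta g] of an automorphism g = (g0, g1) sigma^e consists
    of e and the signs of g0 and g1 on level r - 1; it is a homomorphism onto a
    dihedral group D of order 8, and G contains a copy of D, generated by a_1
    and a_r, on which delta is the identity.  With tau the automorphism of D
    that exchanges the images of a_1 and a_r, an element g lies in G if and only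
    if g0 and g1 lie in G and delta g1 = tau (delta g0); equivalently, that
    relation holds for the sections of g at all vertices.  If g is only in the
    normalizer N, then g0 and g1 are in N and congruent modulo G, and
    delta g1 = tau (delta g0) c with c in the center of D, which has order 2.
    Recording c for the sections of g at the root and at 0, 00, ... gives a
    homomorphism from N to the product of copies of F_2 with kernel G, and it
    maps w_i to the i-th unit vector. *)

From HB Require Import structures.
Require Import Defs.
From mathcomp Require Import all_boot all_order all_fingroup all_algebra.
From mathcomp Require Import all_classical topology.

Set Implicit Arguments.
Unset Strict Implicit.
Unset Printing Implicit Defensive.

Local Open Scope classical_set_scope.
Local Open Scope group_scope.

(** * Coordinates and parities *)

Definition act (g : treeAut) : bool := g [:: false] == [:: true].

(** [g] permutes the two letters and extends prefixes, so the first letter of the image depends only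
    on [b] and on whether [g] swaps. *)
Lemma treeAut_cons (g : treeAut) b s :
  g (b :: s) = (b (+) act g) :: behead (g (b :: s)).
Proof.
have [[g' gK _] g0 _] := autP g; have ginj := can_inj gK.
have g1 c : g [:: c] = [:: c (+) act g].
  have [d0 E0] := treeAut_rcons g [::] false.
  have [d1 E1] := treeAut_rcons g [::] true.
  rewrite /= g0 /= in E0 E1; rewrite /act E0.
  have : d0 != d1.
    apply/eqP => dd.
    by have /ginj : g [:: false] = g [:: true] by rewrite E0 E1 dd.
  by case: c; rewrite ?E0 ?E1; case: d0 d1 {E0 E1} => [] [].
elim/last_ind: s => [|s c IH]; first by rewrite g1.
rewrite -rcons_cons; have [d ->] := treeAut_rcons g (b :: s) c.
by rewrite IH.
Qed.

(* Indexed by the first letter of the image, so that [g] is the product of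
   [pair_aut (coord g false) (coord g true)] and [sigma ^+ act g]. *)
Definition coord_fun (g : treeAut) (c : bool) (s : word) : word :=
  behead (g ((c (+) act g) :: s)).

Lemma coord_funE (g : treeAut) c s : g ((c (+) act g) :: s) = c :: coord_fun g c s.
Proof. by rewrite treeAut_cons addbK. Qed.

Fact coord_subproof g c : is_tree_aut (coord_fun g c).
Proof.
have [gK Kg] := aut_invK g; have [_ _ ge] := autP g.
have inv_cons s : exists t, aut_inv g (c :: s) = (c (+) act g) :: t.
  case E : (aut_inv g (c :: s)) => [|b t].
    by have := Kg (c :: s); rewrite E; have [_ -> _] := autP g.
  have := Kg (c :: s); rewrite E treeAut_cons => -[<- _].
  by exists t; rewrite addbK.
split.
- exists (fun s => behead (aut_inv g (c :: s))) => s.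
    by rewrite -coord_funE gK.
  have [t E] := inv_cons s; rewrite E /=.
  by have := Kg (c :: s); rewrite E coord_funE => -[].
- by have := size_treeAut g [:: c (+) act g]; rewrite coord_funE; case: coord_fun.
- move=> s t; rewrite -[RHS]andTb -[true](eqxx (c (+) act g)) -edge_cons -[RHS]ge.
  by rewrite !coord_funE edge_cons eqxx.
Qed.

Definition coord (g : treeAut) (c : bool) : treeAut := TreeAut (coord_subproof g c).

Lemma coordE (g : treeAut) b s :
  g (b :: s) = (b (+) act g) :: coord g (b (+) act g) s.
Proof. by rewrite -coord_funE addbK. Qed.

Lemma act_pair u v : act (pair_aut u v) = false. Proof. by []. Qed.

Lemma act_sigma : act sigma = true. Proof. by []. Qed.

Lemma act1 : act 1 = false. Proof. by []. Qed.

Lemma treeAut_letter (g : treeAut) b : g [:: b] = [:: b (+) act g].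
Proof. by rewrite coordE; have [_ -> _] := autP (coord g (b (+) act g)). Qed.

Lemma actM g h : act (g * h) = act g (+) act h.
Proof.
by rewrite {1}/act /= !treeAut_letter addFb addbC; case: (_ (+) _).
Qed.

Lemma treeAut_coord_ext g h :
  act g = act h -> (forall c, coord g c = coord h c) -> g = h.
Proof.
move=> agh cgh; apply: treeAut_ext => -[|b s].
  by have [_ -> _] := autP g; have [_ -> _] := autP h.
by rewrite !coordE agh cgh.
Qed.

Lemma coord_pair u v c : coord (pair_aut u v) c = if c then v else u.
Proof. by apply: treeAut_ext => s; rewrite /= /coord_fun act_pair; case: c. Qed.

Lemma coord_sigma c : coord sigma c = 1.
Proof. by apply: treeAut_ext => s; rewrite /= /coord_fun act_sigma; case: c. Qed.

Lemma coord1 c : coord 1 c = 1.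
Proof. by apply: treeAut_ext => s; rewrite /= /coord_fun act1; case: c. Qed.

(** Coordinates are indexed by image letters, so [h] enters at the letter that [g] sends to [c]. *)
Lemma coordM g h c : coord (g * h) c = coord g c * coord h (c (+) act g).
Proof.
apply: treeAut_ext => s; have := coordE (g * h) (c (+) act (g * h)) s.
rewrite addbK actM [LHS]/= coordE coordE addbA addbK addbK.
by case.
Qed.

Lemma pair_autM u v u' v' :
  pair_aut u v * pair_aut u' v' = pair_aut (u * u') (v * v').
Proof. by apply: treeAut_ext => -[|[] s]. Qed.

Lemma pair_aut1 : pair_aut 1 1 = 1.
Proof. by apply: treeAut_ext => -[|[] s]. Qed.

Lemma pair_autV u v : (pair_aut u v)^-1 = pair_aut u^-1 v^-1.
Proof.
by apply: (mulgI (pair_aut u v)); rewrite mulgV pair_autM !mulgV pair_aut1.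
Qed.

Lemma sigma_sqr : sigma * sigma = 1.
Proof. by apply: treeAut_ext => -[|[] s]. Qed.

Lemma sigma_pair u v : sigma * pair_aut u v = pair_aut v u * sigma.
Proof. by apply: treeAut_ext => -[|[] s]. Qed.

Lemma act_pair_sigma u v (b : bool) : act (pair_aut u v * sigma ^+ b) = b.
Proof. by rewrite actM act_pair; case: b; rewrite ?act_sigma ?act1. Qed.

Lemma coord_pair_sigma u v (b c : bool) :
  coord (pair_aut u v * sigma ^+ b) c = if c then v else u.
Proof.
by rewrite coordM coord_pair; case: b; rewrite ?coord_sigma ?coord1 mulg1.
Qed.

Lemma treeAutE g :
  g = pair_aut (coord g false) (coord g true) * sigma ^+ act g.
Proof.
apply: treeAut_coord_ext => [|c]; first by rewrite act_pair_sigma.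
by rewrite coord_pair_sigma; case: c.
Qed.

(** * Agreement up to a given level, limits and signs on levels *)

Lemma cylinder_trans g h f n : cylinder g n h -> cylinder h n f -> cylinder g n f.
Proof. by move=> gh hf s ?; rewrite hf // gh. Qed.

Lemma cylinder_le g h m n : (m <= n)%N -> cylinder g n h -> cylinder g m h.
Proof. by move=> mn gh s sm; rewrite gh // (leq_trans sm). Qed.

Lemma cylinderM g g' h h' n :
  cylinder g n g' -> cylinder h n h' -> cylinder (g * h) n (g' * h').
Proof. by move=> gg hh s sn /=; rewrite hh // gg // size_treeAut. Qed.

Lemma cylinderV g h n : cylinder g n h -> cylinder g^-1 n h^-1.
Proof.
move=> gh s sn; apply: (can_inj (aut_invK h).1).
by rewrite (aut_invK h).2 gh ?(aut_invK g).2 // size_treeAut.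
Qed.

Lemma cylinderX n g m : cylinder 1 n g -> cylinder 1 n (g ^+ m).
Proof.
move=> gn; elim: m => [|m IH]; first by rewrite expg0.
by rewrite expgS -[1]mulg1; exact: cylinderM.
Qed.

Lemma cylinder0 g h : cylinder g 0 h.
Proof. by case=> // _; have [_ -> _] := autP g; have [_ -> _] := autP h. Qed.

Lemma cylinder_act g h n : cylinder g n.+1 h -> act h = act g.
Proof. by move=> gh; rewrite /act gh. Qed.

Lemma cylinder_coord g h n c :
  cylinder g n.+1 h -> cylinder (coord g c) n (coord h c).
Proof.
move=> gh s sn; have /= := gh ((c (+) act g) :: s) sn.
by rewrite !coordE (cylinder_act gh) addbK => -[].
Qed.

Lemma cylinderS g h n : act h = act g ->
  (forall c, cylinder (coord g c) n (coord h c)) -> cylinder g n.+1 h.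
Proof.
move=> agh cgh [|b s] sn; last by rewrite !coordE agh cgh.
by have [_ -> _] := autP g; have [_ -> _] := autP h.
Qed.

Lemma closure_cylinderP A g :
  closure A g <-> forall n, exists2 h, A h & cylinder g n h.
Proof.
split=> [clg n|clg B [n _ nB]].
  have gn : nbhs g (cylinder g n) by exists n.
  by have [h [Ah gh]] := clg _ gn; exists h.
by have [h Ah gh] := clg n; exists h; split=> //; exact: nB.
Qed.

Lemma cvg_cylinderP (u : nat -> treeAut) (g : treeAut) :
  u @ \oo --> g <->
  forall m, exists n0, forall n, (n0 <= n)%N -> cylinder g m (u n).
Proof.
split=> [ug m|ug A [m _ mA]].
  have [n0 _ H] := ug (cylinder g m) (ex_intro2 _ _ m I (fun _ => id)).
  by exists n0 => n /H.
by have [n0 H] := ug m; exists n0 => // n /H /mA.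
Qed.

(** The limit at a word is read off at the index equal to its length. As lengths are preserved, the
    inverse can be read off in the same way. *)
Lemma treeAut_complete (u : nat -> treeAut) :
  (forall m n, (m <= n)%N -> cylinder (u m) m (u n)) ->
  exists g, forall m, cylinder g m (u m).
Proof.
move=> u_le; pose f s := u (size s) s.
have fE n s : (size s <= n)%N -> f s = u n s by move=> sn; rewrite /f (u_le _ _ sn).
have fP : is_tree_aut f.
  split.
  - exists (fun s => (u (size s))^-1 s) => s.
      rewrite [f s]/f size_treeAut.
      exact: (aut_invK _).1.
    rewrite /f size_treeAut; exact: (aut_invK _).2.
  - by rewrite /f; have [_ -> _] := autP (u (size (Nil bool))).
  - move=> s t; pose n := maxn (size s) (size t).
    rewrite (fE n s) ?leq_maxl // (fE n t) ?leq_maxr //.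
    by have [_ _ ->] := autP (u n).
by exists (TreeAut fP) => m s /fE.
Qed.

(* The sign of the action of [g] on level [j + 1]: swaps at depth less than [j]
   permute that level evenly. *)
Fixpoint parity (j : nat) (g : treeAut) : bool :=
  if j is i.+1 then parity i (coord g false) (+) parity i (coord g true)
  else act g.

(** A swap by [g] only permutes the coordinates of [h], which the sum over both does not see. *)
Lemma parityM j g h : parity j (g * h) = parity j g (+) parity j h.
Proof.
elim: j g h => [|j IH] g h /=; first exact: actM.
rewrite !coordM !IH; case: (act g); rewrite /= [LHS]addbACA //.
by rewrite [in LHS](addbC _ (parity j (coord h false))).
Qed.

Lemma parity1 j : parity j 1 = false.
Proof. by elim: j => //= j IH; rewrite !coord1 IH. Qed.

Lemma parity_pair j u v : parity j.+1 (pair_aut u v) = parity j u (+) parity j v.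
Proof. by rewrite /= !coord_pair. Qed.

Lemma parity_diag j u : parity j (pair_aut u u) = false.
Proof. by case: j => // j; rewrite parity_pair addbb. Qed.

Lemma parity_sigma j : parity j sigma = (j == 0%N).
Proof. by case: j => //= j; rewrite !coord_sigma addbb. Qed.

Lemma cylinder_parity g h j n :
  (j < n)%N -> cylinder g n h -> parity j h = parity j g.
Proof.
elim: j g h n => [|j IH] g h [|n] //= jn gh; first exact: cylinder_act gh.
by rewrite !(IH _ _ _ jn (cylinder_coord _ gh)).
Qed.

(** * The dihedral group of order 8 *)

(* [(p, q, e)] stands for (p, q) sigma^e in the wreath product of F_2 by
   <sigma>. *)
Definition dih : Type := (bool * bool * bool)%type.
HB.instance Definition _ := Choice.copy dih (bool * bool * bool)%type.

Definition dih_mul (x y : dih) : dih :=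
  let: (p, q, e) := x in let: (p', q', e') := y in
  (p (+) (if e then q' else p'), q (+) (if e then p' else q'), e (+) e').

Definition dih_one : dih := (false, false, false).

Definition dih_inv (x : dih) : dih :=
  let: (p, q, e) := x in if e then (q, p, e) else x.

Fact dih_mulA : associative dih_mul.
Proof. by do 3 case=> [[[] []] []]. Qed.
Fact dih_mul1g : left_id dih_one dih_mul.
Proof. by case=> [[[] []] []]. Qed.
Fact dih_mulg1 : right_id dih_one dih_mul.
Proof. by case=> [[[] []] []]. Qed.
Fact dih_mulVg : left_inverse dih_one dih_inv dih_mul.
Proof. by case=> [[[] []] []]. Qed.
Fact dih_mulgV : right_inverse dih_one dih_inv dih_mul.
Proof. by case=> [[[] []] []]. Qed.

HB.instance Definition _ := isGroup.Build dih
  dih_mulA dih_mul1g dih_mulg1 dih_mulVg dih_mulgV.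

(* The automorphism that exchanges (0, 0, 1) and (1, 0, 0), the images of a_1
   and a_r under [delta]. *)
Definition dih_tau (x : dih) : dih :=
  let: (p, q, e) := x in
  (q (+) (e && ~~ (p (+) q)), q (+) (e && (p (+) q)), p (+) q).

(** The central involution, the square of the product of the two generators that [dih_tau]
    exchanges. *)
Definition dih_z : dih := (true, true, false).

Lemma dih_tauM x y : dih_tau (x * y) = dih_tau x * dih_tau y.
Proof. by move: x y; do 2 case=> [[[] []] []]. Qed.

Lemma dih_tauK : involutive dih_tau.
Proof. by case=> [[[] []] []]. Qed.

Lemma dih_tau1 : dih_tau 1 = 1.
Proof. by []. Qed.

Lemma dih_tauV x : dih_tau x^-1 = (dih_tau x)^-1.
Proof. by move: x; case=> [[[] []] []]. Qed.

Lemma dih_zC x : dih_z * x = x * dih_z.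
Proof. by move: x; case=> [[[] []] []]. Qed.

Lemma dih_center c : (forall x, c * x = x * c) -> exists b : bool, c = dih_z ^+ b.
Proof.
(* Commuting with the two generators already leaves only 1 and [dih_z]. *)
move=> cC; have := (cC (false, false, true), cC (true, false, false)).
case: c {cC} => [[[] []] []] [] // _ _; first by exists true.
by exists false.
Qed.

(** * Normalizers and cosets *)

Lemma NormP (W : groupType) (G : set W) n : is_subgroup G ->
  Norm G n <-> forall g, G g -> G (n * g * n^-1) /\ G (n^-1 * g * n).
Proof.
move=> [G1 GM GV]; split=> [nG g Gg | nG].
  split; first by rewrite -nG; exists g.
  have : G g by [].
  rewrite -[in X in X -> _]nG => -[h Gh <-].
  by rewrite !mulgA mulVg mul1g -mulgA mulVg mulg1.
apply/seteqP; split=> [_ [g Gg <-]|g Gg]; first by case: (nG g Gg).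
exists (n^-1 * g * n); first by case: (nG g Gg).
by rewrite !mulgA mulgV mul1g -mulgA mulgV mulg1.
Qed.

Lemma Norm_subgroup (W : groupType) (G : set W) :
  is_subgroup G -> is_subgroup (Norm G).
Proof.
move=> GG; split.
- by apply/NormP => // g Gg; rewrite invg1 !mul1g !mulg1.
- move=> x y /(NormP _ GG) Nx /(NormP _ GG) Ny; apply/NormP => // g Gg.
  have [/Nx [+ _] _] := Ny g Gg; have [_ /Ny [_ +]] := Nx g Gg.
  by rewrite !invgM !mulgA.
- move=> x /(NormP _ GG) Nx; apply/NormP => // g Gg.
  by rewrite invgK; have [] := Nx g Gg.
Qed.

Lemma sub_Norm (W : groupType) (G : set W) : is_subgroup G -> G `<=` Norm G.
Proof.
move=> GG; have [G1 GM GV] := GG; move=> x Gx; apply/NormP => // g Gg.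
have Gx1 := GV _ Gx.
by split; do 2 apply: (GM) => //.
Qed.

Lemma subgroup_gen_subgroup (W : groupType) (A : set W) :
  is_subgroup (subgroup_gen A).
Proof.
split.
- by move=> B [[]].
- by move=> x y Ax Ay B BP; have [_ + _] := BP.1; apply; [exact: Ax|exact: Ay].
- by move=> x Ax B BP; have [_ _ +] := BP.1; apply; exact: Ax.
Qed.

Lemma involution_expg (W : groupType) (x : W) (b c : bool) :
  x * x = 1 -> x ^+ b * x ^+ c = x ^+ (b (+) c).
Proof. by case: b c => [] [] //= xx; rewrite ?mulg1 ?mul1g. Qed.

Lemma lcos_eqP (W : groupType) (G : set W) g h : is_subgroup G ->
  lcos g G = lcos h G <-> G (g^-1 * h).
Proof.
move=> [G1 GM GV]; split=> [gh|Ggh].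
  have : lcos h G h by exists 1; rewrite ?mulg1.
  by rewrite -gh => -[x Gx <-]; rewrite mulKg.
apply/seteqP; split=> _ [x Gx <-].
  exists ((g^-1 * h)^-1 * x); first by apply: GM => //; exact: GV.
  by rewrite invgM invgK !mulgA mulgV mul1g.
by exists (g^-1 * h * x); [exact: GM|rewrite -!mulgA mulVKg].
Qed.

(** Exponents in [phi] are read as natural numbers; [odd] identifies F_2 with the booleans in which
    [kappa] takes its values. *)
Lemma odd_F2_inj (x y : 'F_2) : odd x = odd y -> x = y.
Proof.
by case: x y => [[|[|]] //] ? [[|[|]] //] ? // _; exact: val_inj.
Qed.

Lemma odd_F2D (x y : 'F_2) : odd (x + y)%R = odd x (+) odd y.
Proof. by case: x y => [[|[|]] //] ? [[|[|]] //] ?. Qed.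

(** * The group G *)

Section PinkGroup.
Variables (r : nat) (a : nat -> treeAut).
Hypotheses (r3 : (3 <= r)%N) (recP : recursion r a).

Let Gamma := subgroup_gen [set a i | i in [set i | (1 <= i <= r)%N]].
Let G := grpG r a.
Let N := Norm G.

Let gen_subgroup : is_subgroup Gamma.
Proof. exact: subgroup_gen_subgroup. Qed.

Lemma gen_mem i : (1 <= i <= r)%N -> Gamma (a i).
Proof. by move=> ir A [_]; apply; exists i. Qed.

Lemma gen_ind (P : set treeAut) : is_subgroup P ->
  (forall i, (1 <= i <= r)%N -> P (a i)) -> Gamma `<=` P.
Proof. by move=> PP Pa g; apply; split=> // _ [i ir <-]; exact: Pa. Qed.

Lemma a1E : a 1%N = sigma. Proof. by case: recP. Qed.
Lemma a2E : a 2%N = pair_aut (a 1%N) (a r). Proof. by case: recP. Qed.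
Lemma aE i : (3 <= i <= r)%N -> a i = pair_aut (a i.-1) 1.
Proof. by case: recP => _ _; apply. Qed.
Lemma arE : a r = pair_aut (a r.-1) 1.
Proof. by rewrite aE // r3 leqnn. Qed.

Lemma a_sqr i : (1 <= i <= r)%N -> a i * a i = 1.
Proof.
move=> ir; apply: treeAut_ext => s.
elim: s i ir => [|c s IH] [|[|[|i]]] // ir; rewrite /=.
- by rewrite a1E.
- by rewrite a2E.
- by rewrite (@aE i.+3 ir).
- by rewrite a1E /= negbK.
- rewrite a2E; case: c => /=; congr cons; apply: (IH).
  + by rewrite leqnn (leq_trans _ r3).
  + by rewrite (leq_trans _ r3).
- rewrite (@aE i.+3 ir); case: c => //=; congr cons; apply: IH.
  by case/andP: ir => _ /ltnW.
Qed.

(** The only swap of a_1 is at depth 0, and each recursion step moves it one level down. In this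
    range the coordinate a_r of a_2 contributes nothing. *)
Lemma parity_a i j : (1 <= i <= r)%N -> (j < r.-1)%N -> parity j (a i) = (i == j.+1).
Proof.
elim: j i => [|j IH] [|[|[|i]]] // ir jr; first 1 last.
- by rewrite /= a2E.
- by rewrite (@aE i.+3 ir).
- by rewrite a1E parity_sigma.
- rewrite a2E parity_pair !IH ?(ltnW jr) ?leqnn ?(leq_trans _ r3) //.
  rewrite [r == _](_ : _ = false) ?addbF //.
  by apply/negbTE; rewrite neq_ltn orbC (leq_trans jr) // leq_pred.
- rewrite (@aE i.+3 ir) parity_pair parity1 addbF IH ?(ltnW jr) //.
  by case/andP: ir => _ /ltnW.
- by rewrite a1E.
Qed.

(** * The homomorphism [delta] and its section *)

(** Depth [r.-2] is where a_(r-1), the nontrivial coordinate of a_r, has odd parity. *)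
Definition delta (g : treeAut) : dih :=
  (parity r.-2 (coord g false), parity r.-2 (coord g true), act g).

Arguments delta : simpl never.
Arguments dih_tau : simpl never.

Lemma deltaM g h : delta (g * h) = delta g * delta h.
Proof.
by rewrite /delta !coordM !parityM actM /mulg /=; case: (act g).
Qed.

Lemma delta1 : delta 1 = 1.
Proof. by rewrite /delta !coord1 !parity1 act1. Qed.

Lemma deltaV g : delta g^-1 = (delta g)^-1.
Proof. by apply: (mulgI (delta g)); rewrite -deltaM !mulgV delta1. Qed.

Lemma delta_pair u v : delta (pair_aut u v) = (parity r.-2 u, parity r.-2 v, false).
Proof. by rewrite /delta !coord_pair act_pair. Qed.

Lemma delta_sigma : delta sigma = (false, false, true).
Proof. by rewrite /delta !coord_sigma !parity1. Qed.

Lemma r2E : r.-2.+1 = r.-1. Proof. by case: r r3 => [|[|]]. Qed.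
Lemma r1E : r.-1.+1 = r. Proof. by case: r r3. Qed.

Lemma r1_range : (1 <= r.-1 <= r)%N.
Proof. by rewrite leq_pred -ltnS r1E (leq_trans _ r3). Qed.

(** All generators but a_1 and a_r lie in the kernel of [delta]; for a_2 = (a_1, a_r) this uses 1 <
    r - 1. *)
Lemma delta_a i : (1 <= i <= r)%N -> delta (a i) = (i == r, false, i == 1%N).
Proof.
have r2 : (r.-2 < r.-1)%N by rewrite r2E.
have r_gt1 : (1 < r)%N by rewrite (leq_trans _ r3).
case: i => [|[|[|i]]] // ir.
- by rewrite a1E delta_sigma [1%N == r]ltn_eqF.
- rewrite a2E delta_pair !parity_a ?leqnn ?(ltnW r_gt1) // r2E.
  rewrite [2%N == r]ltn_eqF // [1%N == _]ltn_eqF; last by rewrite -ltnS r1E.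
  by rewrite [r == _]gtn_eqF // r1E.
- rewrite (@aE i.+3 ir) delta_pair parity1 parity_a //; last first.
    by case/andP: ir => _ /ltnW.
  by rewrite r2E -[r in RHS]r1E eqSS.
Qed.

(** Continuity of [delta], by which relations between its values pass to the closure of [Gamma]. *)
Lemma cylinder_delta g h n : (r <= n)%N -> cylinder g n h -> delta h = delta g.
Proof.
case: n => [|n] rn gh; first by have := leq_trans r3 rn.
rewrite /delta (cylinder_act gh).
have rn' : (r.-2 < n)%N by rewrite r2E -ltnS r1E.
by rewrite !(cylinder_parity rn' (cylinder_coord _ gh)).
Qed.

(* A section of [delta] with image generated by a_1 and a_r = (a_(r-1), 1). *)
Definition emb (d : dih) : treeAut :=
  let: (p, q, e) := d in pair_aut (a r.-1 ^+ p) (a r.-1 ^+ q) * sigma ^+ e.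

Lemma emb1 : emb 1 = 1.
Proof. by rewrite /= !expg0 pair_aut1 mulg1. Qed.

Lemma embM x y : emb (x * y) = emb x * emb y.
Proof.
case: x y => [[p q] e] [[p' q'] e']; rewrite [x in emb x]/mulg /=.
have xx := a_sqr r1_range; rewrite -!involution_expg ?sigma_sqr // -pair_autM.
case: e => /=; last by rewrite expg0 mul1g mulg1 mulgA.
by rewrite expg1 -!mulgA; congr (_ * _); rewrite !mulgA sigma_pair.
Qed.

Lemma embV x : emb x^-1 = (emb x)^-1.
Proof. by apply: (mulgI (emb x)); rewrite -embM !mulgV emb1. Qed.

Lemma delta_emb x : delta (emb x) = x.
Proof.
case: x => [[p q] e]; rewrite /= deltaM delta_pair.
have parity_x (b : bool) : parity r.-2 (a r.-1 ^+ b) = b.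
  case: b; last by rewrite expg0 parity1.
  by rewrite expg1 parity_a ?r1_range // r2E ?eqxx.
rewrite !parity_x; case: e; last by rewrite expg0 delta1 mulg1.
by rewrite expg1 delta_sigma; case: p q => [] [].
Qed.

(** * Membership in [Gamma] and in G in terms of coordinates *)

Lemma gen_sigma : Gamma sigma.
Proof. by rewrite -a1E; apply: gen_mem; rewrite (leq_trans _ r3). Qed.

Lemma gen_pairC u v : Gamma (pair_aut u v) -> Gamma (pair_aut v u).
Proof.
have [_ GM _] := gen_subgroup; have Gs := gen_sigma => Guv.
have -> : pair_aut v u = sigma * pair_aut u v * sigma.
  by rewrite sigma_pair -mulgA sigma_sqr mulg1.
by do !apply: (GM).
Qed.

Lemma gen_emb x : Gamma (emb x).
Proof.
have [G1 GM _] := gen_subgroup; have Gs := gen_sigma.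
have Gr : Gamma (pair_aut (a r.-1) 1).
  by rewrite -arE; apply: gen_mem; rewrite leqnn (leq_trans _ r3).
case: x => [[p q] e]; rewrite /=; apply: (GM); last by case: e.
rewrite -[_ ^+ p]mulg1 -[_ ^+ q]mul1g -pair_autM; apply: GM.
  by case: p; rewrite // expg0 pair_aut1.
by apply: gen_pairC; case: q; rewrite // expg0 pair_aut1.
Qed.

(** The pair is multiplicative in [v], so generators suffice: up to exchanging the coordinates, a_1
    and a_r both give a_2, and any other a_i gives a_(i+1). *)
Lemma gen_pair_emb v : Gamma v -> Gamma (pair_aut (emb (dih_tau (delta v))) v).
Proof.
have [G1 GM GV] := gen_subgroup.
apply: (@gen_ind (fun v => Gamma (pair_aut (emb (dih_tau (delta v))) v))).
  split.
  - by rewrite delta1 emb1 pair_aut1.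
  - by move=> x y Gx Gy; rewrite deltaM dih_tauM embM -pair_autM; exact: GM.
  - by move=> x Gx; rewrite deltaV dih_tauV embV -pair_autV; exact: GV.
have r_gt1 : (1 < r)%N by rewrite (leq_trans _ r3).
move=> i ir; rewrite delta_a //.
have [->|i1] := eqVneq i 1%N.
  rewrite [1%N == r]ltn_eqF // /dih_tau /= expg1 !expg0 mulg1 -arE.
  by apply: gen_pairC; rewrite -a2E; apply: gen_mem; rewrite r_gt1.
have [->|ir'] := eqVneq i r.
  rewrite /dih_tau /= !expg0 pair_aut1 mul1g expg1 -a1E -a2E.
  by apply: gen_mem; rewrite r_gt1.
rewrite /dih_tau /= !expg0 pair_aut1 mul1g; apply: gen_pairC.
have i3 : (3 <= i.+1 <= r)%N.
  by rewrite [(i < r)%N]ltn_neqAle ir'; case: i i1 ir {ir'} => [|[]].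
have /= <- := aE i3; apply: gen_mem; by case/andP: i3 => _ ->.
Qed.

Lemma gen_pair u v : Gamma u -> Gamma v -> delta v = dih_tau (delta u) ->
  Gamma (pair_aut u v).
Proof.
move=> Gu Gv uv; have [_ GM GV] := gen_subgroup.
(* This element w has trivial [delta], so (w, 1) is in [Gamma]; it corrects the first coordinate of
   the pair built from [v] to [u]. *)
have Gw : Gamma ((emb (dih_tau (delta v)))^-1 * u).
  by apply: GM => //; apply: GV; exact: gen_emb.
have := gen_pair_emb Gw.
rewrite deltaM deltaV delta_emb uv dih_tauK mulVg dih_tau1 emb1 => /gen_pairC.
have /GM H := gen_pair_emb Gv; move=> /H.
by rewrite pair_autM mulg1 uv dih_tauK mulgA mulgV mul1g.
Qed.

(** The relation holds for the generators and survives products and inverses: [dih_tau] is an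
    involutive automorphism, so exchanging the coordinates preserves it. *)
Lemma gen_coord g : Gamma g ->
  (forall c, Gamma (coord g c)) /\
  delta (coord g true) = dih_tau (delta (coord g false)).
Proof.
have [G1 GM GV] := gen_subgroup.
pose P g := (forall c, Gamma (coord g c)) /\
  delta (coord g true) = dih_tau (delta (coord g false)).
have r_gt1 : (1 < r)%N by rewrite (leq_trans _ r3).
have PV x : P x -> P x^-1.
  have xE c : coord x^-1 c = (coord x (c (+) act x))^-1.
    apply: (mulgI (coord x (c (+) act x))); rewrite mulgV.
    by have := coordM x x^-1 (c (+) act x); rewrite mulgV coord1 addbK => <-.
  move=> [Px xd]; split=> [c|]; rewrite !xE; first exact: GV.
  by case: (act x); rewrite /= !deltaV dih_tauV ?xd ?dih_tauK.
apply: (@gen_ind P) => [|i ir].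
  split=> //.
  - by split=> [c|]; rewrite !coord1 // delta1.
  - move=> x y [Px xd] [Py yd]; split=> [c|]; rewrite !coordM; first exact: GM.
    by case: (act x); rewrite /= !deltaM dih_tauM xd yd ?dih_tauK.
case: i ir => [|[|[|i]]] // ir.
- by rewrite a1E; split=> [c|]; rewrite !coord_sigma // delta1.
- rewrite a2E; split=> [c|]; rewrite !coord_pair.
    by case: c; apply: gen_mem; rewrite ?leqnn ltnW.
  rewrite !delta_a ?leqnn ?(ltnW r_gt1) // eqxx.
  by rewrite [1%N == r]ltn_eqF // [r == _]gtn_eqF.
- rewrite (@aE i.+3 ir); split=> [c|]; rewrite !coord_pair.
    case: c => //; apply: gen_mem; by case/andP: ir => _ /ltnW.
  have ir2 : (1 <= i.+2 <= r)%N by case/andP: ir => _ /ltnW.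
  rewrite delta1 delta_a //= [_ == r]ltn_eqF //.
Qed.

Lemma gen_sub_grpG : Gamma `<=` G.
Proof. exact: subset_closure. Qed.

Lemma grpG_coordP g : G g <->
  (forall c, G (coord g c)) /\
  delta (coord g true) = dih_tau (delta (coord g false)).
Proof.
split=> [/closure_cylinderP clg|[Gg gd]].
  split=> [c|].
    apply/closure_cylinderP => n; have [h Gh gh] := clg n.+1.
    exists (coord h c); last exact: cylinder_coord gh.
    exact: (gen_coord Gh).1.
  have [h Gh gh] := clg r.+1; have [_ hd] := gen_coord Gh.
  rewrite -(cylinder_delta (leqnn r) (cylinder_coord true gh)).
  by rewrite -(cylinder_delta (leqnn r) (cylinder_coord false gh)).
have [G1 GM _] := gen_subgroup.
(* Level at least [r] makes the approximations of the coordinates exact under [delta], so that they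
   can be paired in [Gamma]. *)
apply/closure_cylinderP => n; pose m := maxn n r.
have /closure_cylinderP/(_ m) [h0 Gh0 gh0] := Gg false.
have /closure_cylinderP/(_ m) [h1 Gh1 gh1] := Gg true.
exists (pair_aut h0 h1 * sigma ^+ act g).
  apply: GM; last first.
    by case: (act g); [exact: gen_sigma|exact: G1].
  apply: gen_pair => //.
  by rewrite (cylinder_delta _ gh0) ?(cylinder_delta _ gh1) ?leq_maxr.
apply: (@cylinder_le _ _ _ m.+1); first by rewrite leqW // leq_maxl.
apply: cylinderS => [|c]; first by rewrite act_pair_sigma.
by rewrite coord_pair_sigma; case: c.
Qed.

(** Start from [emb (delta g)] and correct the parities in order of depth: for 0 < m < r - 1,
    multiplying by a_(m+1) changes the parity at depth m, no other one in range, and not [delta]. *)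
Lemma gen_match g : exists2 h, Gamma h &
  delta h = delta g /\ forall j, (j < r.-1)%N -> parity j h = parity j g.
Proof.
have [G1 GM _] := gen_subgroup.
suff H m : (m <= r.-1)%N -> exists2 h, Gamma h &
    delta h = delta g /\ forall j, (j < m)%N -> parity j h = parity j g.
  exact: H.
elim: m => [_|m IH mr].
  by exists (emb (delta g)); [exact: gen_emb|rewrite delta_emb].
have [h Gh [hd hp]] := IH (ltnW mr).
have [hm|hm] := eqVneq (parity m h) (parity m g).
  exists h => //; split=> // j; rewrite ltnS leq_eqVlt => /orP[/eqP->//|].
  exact: hp.
(* The parity at depth 0 is [act], a component of [delta], and agrees already. *)
have m0 : (0 < m)%N.
  by case: m hm {IH mr hp} => //=; move: hd => [_ _ ->]; rewrite eqxx.
have mr1 : (m.+1 < r)%N by rewrite -[X in (_ < X)%N]r1E ltnS.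
have m1r : (1 <= m.+1 <= r)%N by exact: (ltnW mr1).
exists (h * a m.+1); first by apply: GM => //; exact: gen_mem.
have da : delta (a m.+1) = 1 by rewrite delta_a // ltn_eqF // eqSS gtn_eqF.
split; first by rewrite deltaM da mulg1.
move=> j jm; rewrite parityM parity_a ?(leq_trans jm) //.
move: jm; rewrite ltnS leq_eqVlt eqSS => /orP[/eqP->|jm].
  by move: hm; rewrite eqxx; do 2 case: parity.
by rewrite gtn_eqF // addbF hp.
Qed.

(** Approximations of the two sections are glued, by induction on the level, starting from
    [gen_match]. *)
Lemma grpG_coind (P : set treeAut) :
  (forall g, P g -> (forall c, P (coord g c)) /\
    delta (coord g true) = dih_tau (delta (coord g false))) ->
  P `<=` G.
Proof.
have [G1 GM _] := gen_subgroup.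
move=> HP g Pg; apply/closure_cylinderP => n.
(* Gluing needs the right [delta] on both coordinates, and [delta] of the glued element is computed
   from their parities; hence both are carried along. *)
suff [h Gh [gh _ _]] : exists2 h, Gamma h & [/\ cylinder g n h, delta h = delta g &
    forall j, (j < r.-1)%N -> parity j h = parity j g] by exists h.
elim: n g Pg => [|n IH] g Pg.
  have [h Gh [hd hp]] := gen_match g.
  by exists h => //; split=> //; exact: cylinder0.
have [Pc gd] := HP g Pg.
have [h0 Gh0 [gh0 hd0 hp0]] := IH _ (Pc false).
have [h1 Gh1 [gh1 hd1 hp1]] := IH _ (Pc true).
exists (pair_aut h0 h1 * sigma ^+ act g).
  apply: GM; last first.
    by case: (act g); [exact: gen_sigma|exact: G1].
  by apply: gen_pair => //; rewrite hd0 hd1.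
split.
- apply: cylinderS => [|c]; first by rewrite act_pair_sigma.
  by rewrite coord_pair_sigma; case: c.
- by rewrite /delta !coord_pair_sigma act_pair_sigma hp0 ?hp1 // -r2E.
- case=> [|j] jr /=; first by rewrite act_pair_sigma.
  by rewrite !coord_pair_sigma hp0 ?hp1 // ltnW.
Qed.

Let GG : is_subgroup G := grpG_subgroup r a.
Let NG : is_subgroup N := Norm_subgroup GG.

Lemma grpG_emb x : G (emb x).
Proof. by apply: gen_sub_grpG; exact: gen_emb. Qed.

Lemma grpG_pairP u v : G (pair_aut u v) <->
  [/\ G u, G v & delta v = dih_tau (delta u)].
Proof.
split=> [/grpG_coordP[Gc]|[Gu Gv uv]]; last first.
  by apply/grpG_coordP; rewrite !coord_pair; split=> // -[]; rewrite coord_pair.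
rewrite !coord_pair => uv; have := (Gc true, Gc false).
by rewrite !coord_pair => -[].
Qed.

Lemma grpG_sigma : G sigma.
Proof. by apply: gen_sub_grpG; exact: gen_sigma. Qed.

Lemma grpG_sigmaX (b : bool) : G (sigma ^+ b).
Proof. by have [G1 _ _] := GG; case: b; [exact: grpG_sigma|exact: G1]. Qed.

(** * The normalizer *)

(** On pairs, the central factor cancels under conjugation; on [sigma], conjugation yields the
    quotients of [n0] and [n1], which lie in G. *)
Lemma Norm_pair n0 n1 : N n0 -> N n1 -> G (n0 * n1^-1) ->
  (exists b : bool, delta n1 = dih_tau (delta n0) * dih_z ^+ b) ->
  N (pair_aut n0 n1).
Proof.
have [G1 GM GV] := GG.
have zC (b : bool) x : dih_z ^+ b * x = x * dih_z ^+ b.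
  by case: b; rewrite ?dih_zC // expg0 mul1g mulg1.
have zz (b : bool) (x y : dih) : x * dih_z ^+ b * y * dih_z ^+ b = x * y.
  by rewrite -mulgA -(zC b y) mulgA -[x * _ * _]mulgA; case: b; rewrite ?mulg1.
(* Stated for arbitrary [m0] and [m1], to be applied to the inverses as well. *)
have conj m0 m1 : N m0 -> N m1 -> G (m0 * m1^-1) ->
    (exists b : bool, delta m1 = dih_tau (delta m0) * dih_z ^+ b) ->
    forall g, G g -> G (pair_aut m0 m1 * g * (pair_aut m0 m1)^-1).
  move=> /(NormP _ GG) Nm0 /(NormP _ GG) Nm1 mm [b md] g.
  have zV : (dih_z ^+ b)^-1 = dih_z ^+ b by case: (b).
  have md0 : dih_tau (delta m1) = delta m0 * dih_z ^+ b.
    by rewrite md dih_tauM dih_tauK; case: (b).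
  have mm' : G (m1 * m0^-1) by have := GV _ mm; rewrite invgM invgK.
  move=> /grpG_coordP[Gc gd]; rewrite [g]treeAutE.
  case: (act g); last first.
    rewrite expg0 mulg1 pair_autV !pair_autM; apply/grpG_pairP; split.
    - by have [] := Nm0 _ (Gc false).
    - by have [] := Nm1 _ (Gc true).
    - rewrite !deltaM !deltaV !dih_tauM !dih_tauV gd md invgM zV.
      by rewrite mulgA zz.
  rewrite expg1 -!mulgA pair_autV sigma_pair !mulgA !pair_autM.
  apply: (GM); last exact: grpG_sigma.
  apply/grpG_pairP; split.
  (* With g0 the first coordinate of [g]: m0 g0 m1^-1 = (m0 g0 m0^-1)(m0 m1^-1). *)
  - rewrite -[m0 * _](mulgVK m0) -mulgA.
    by apply: GM => //; have [] := Nm0 _ (Gc false).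
  - rewrite -[m1 * _](mulgVK m1) -mulgA.
    by apply: GM => //; have [] := Nm1 _ (Gc true).
  - rewrite !deltaM !deltaV !dih_tauM !dih_tauV gd md0 md invgM zV.
    by rewrite -!mulgA ![dih_z ^+ b * _]zC -!mulgA.
move=> Nn0 Nn1 nn nd; apply/NormP => // g Gg; split; first exact: conj.
have := @conj n0^-1 n1^-1; rewrite -pair_autV !invgK; apply=> //.
- by case: NG => _ _; apply.
- by case: NG => _ _; apply.
- rewrite -[n0^-1 * n1]invgK; apply: (GV).
  rewrite invgM invgK.
  have /(NormP _ GG)/(_ _ nn) [_] := Nn1; rewrite -!mulgA mulVg mulg1.
  by [].
- case: nd => b nd; exists b.
  by rewrite !deltaV nd invgM dih_tauV; case: b {nd} => //; rewrite ?zC.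
Qed.

(** Each conclusion comes from conjugating suitable elements of G: pairs with one coordinate
    arbitrary in G and the other in the image of [emb], then [sigma], then all pairs of
    [emb (dih_tau x)] and [emb x], which force the defect to commute with every [x]. *)
Lemma Norm_pair_inv n0 n1 : N (pair_aut n0 n1) ->
  [/\ N n0, N n1, G (n0 * n1^-1) &
      exists b : bool, delta n1 = dih_tau (delta n0) * dih_z ^+ b].
Proof.
have [G1 GM GV] := GG.
move=> /(NormP _ GG) Nn; split.
- apply/NormP => // g Gg.
  have /Nn : G (pair_aut g (emb (dih_tau (delta g)))).
    by apply/grpG_pairP; rewrite delta_emb; split=> //; exact: grpG_emb.
  by rewrite pair_autV !pair_autM => -[/grpG_pairP[+ _ _] /grpG_pairP[+ _ _]].
- apply/NormP => // g Gg.
  have /Nn : G (pair_aut (emb (dih_tau (delta g))) g).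
    by apply/grpG_pairP; rewrite delta_emb dih_tauK; split=> //; exact: grpG_emb.
  by rewrite pair_autV !pair_autM => -[/grpG_pairP[_ + _] /grpG_pairP[_ + _]].
- have [+ _] := Nn _ grpG_sigma.
  rewrite -mulgA pair_autV sigma_pair mulgA pair_autM => /GM/(_ (GV _ grpG_sigma)).
  by rewrite mulgK => /grpG_pairP[].
- suff [b Hb] : exists b : bool, (dih_tau (delta n0))^-1 * delta n1 = dih_z ^+ b.
    by exists b; rewrite -Hb mulVKg.
  apply: dih_center => x.
  have /Nn[] : G (pair_aut (emb (dih_tau x)) (emb x)).
    by apply/grpG_pairP; rewrite !delta_emb dih_tauK; split=> //; exact: grpG_emb.
  rewrite pair_autV !pair_autM => /grpG_pairP[_ _].
  rewrite !deltaM !deltaV !dih_tauM !dih_tauV !delta_emb dih_tauK => E _.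
  apply: (mulgI (dih_tau (delta n0))); rewrite !mulgA mulgV mul1g.
  by rewrite -E mulgVK.
Qed.

Lemma Norm_coord n : N n ->
  [/\ forall c, N (coord n c), G (coord n false * (coord n true)^-1) &
      exists b : bool,
        delta (coord n true) = dih_tau (delta (coord n false)) * dih_z ^+ b].
Proof.
have [_ NM NV] := NG; have GN := sub_Norm GG.
rewrite {1}[n]treeAutE => /NM/(_ (NV _ (GN _ (@grpG_sigmaX (act n))))).
by rewrite mulgK => /Norm_pair_inv[N0 N1 ? ?]; split=> // -[].
Qed.

(** * The central defects of elements of N *)

(* On N the two values below differ at most by the central element [dih_z]. *)
Fixpoint kappa (i : nat) (g : treeAut) : bool :=
  if i is j.+1 then kappa j (coord g false)
  else delta (coord g true) != dih_tau (delta (coord g false)).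

Lemma kappa_grpG i g : G g -> kappa i g = false.
Proof.
elim: i g => [|i IH] g /grpG_coordP[Gc gd] /=; last exact: IH.
by rewrite gd eqxx.
Qed.

(** At the root the defects are central, and a check over the dihedral group suffices. Further down,
    a swap by [g] replaces one coordinate of [h] by the other; they are congruent modulo G, where
    [kappa] vanishes. *)
Lemma kappaM i g h : N g -> N h -> kappa i (g * h) = kappa i g (+) kappa i h.
Proof.
have [_ NM NV] := NG; have GN := sub_Norm GG.
elim: i g h => [|i IH] g h Ng Nh.
  have [_ _ [b gd]] := Norm_coord Ng; have [_ _ [c hd]] := Norm_coord Nh.
  rewrite /= !coordM !deltaM; case: (act g); rewrite /= gd hd;
    move: (delta _) (delta _) b c {gd hd}.
    by do 2 case=> [[[] []] []]; do 2 case.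
  by do 2 case=> [[[] []] []]; do 2 case.
have [Ngc _ _] := Norm_coord Ng; have [Nhc Gh _] := Norm_coord Nh.
rewrite /= coordM IH //; case: (act g) => //=; congr (_ (+) _).
rewrite -[coord h false](mulgVK (coord h true)) IH ?(kappa_grpG _ Gh) //.
exact: GN.
Qed.

Lemma kappa1 i : kappa i 1 = false.
Proof. by apply: kappa_grpG; case: GG. Qed.

Lemma kappaV i g : N g -> kappa i g^-1 = kappa i g.
Proof.
have [_ _ NV] := NG.
by move=> Ng; have := kappaM i Ng (NV _ Ng); rewrite mulgV kappa1; do 2 case: kappa.
Qed.

(** Coinduction: vanishing of all [kappa] passes to the section at 0 by shifting the index, and to
    the section at 1 because that one is congruent to it modulo G. *)
Lemma kappa_ker g : N g -> (forall i, kappa i g = false) -> G g.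
Proof.
move=> Ng kg; pose P g := N g /\ forall i, kappa i g = false.
apply: (@grpG_coind P) => //.
have GN := sub_Norm GG; have [_ _ NV] := NG.
move=> {Ng kg}g [Ng kg]; have [Nc Gc _] := Norm_coord Ng; split; last first.
  by have /= /negbFE/eqP := kg 0%N.
move=> c; split=> // i; case: c; last exact: (kg i.+1).
rewrite -[RHS](kg i.+1) /= -[coord g false](mulgVK (coord g true)) kappaM //.
  by rewrite (kappa_grpG _ Gc).
exact: GN.
Qed.

Lemma cylinder_kappa i g h n :
  (i + r < n)%N -> cylinder g n h -> kappa i h = kappa i g.
Proof.
elim: i g h n => [|i IH] g h [|n] //= irn gh; last first.
  exact: IH irn (cylinder_coord _ gh).
by rewrite !(cylinder_delta irn (cylinder_coord _ gh)).
Qed.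

(** G is closed and conjugation is continuous, so N is closed. *)
Lemma Norm_cylinder g : (forall n, exists2 h, N h & cylinder g n h) -> N g.
Proof.
move=> clg; apply/NormP => // x Gx.
split; apply/closure_cylinderP => n.
all: have [h /(NormP _ GG)/(_ _ Gx) [G1 G2] gh] := clg n.
  have /closure_cylinderP/(_ n) [y Gy xy] := G1.
  exists y => //; apply: cylinder_trans xy.
  by do !apply: cylinderM => //; exact: cylinderV.
have /closure_cylinderP/(_ n) [y Gy xy] := G2.
exists y => //; apply: cylinder_trans xy.
by do !apply: cylinderM => //; exact: cylinderV.
Qed.

(** * The elements w_i and the map phi *)

Lemma z_pair : (a 1%N * a r) ^+ 2 = pair_aut (a r.-1) (a r.-1).
Proof.
rewrite expgS expg1 a1E arE -mulgA (mulgA (pair_aut _ _)) -sigma_pair.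
by rewrite !mulgA sigma_sqr mul1g pair_autM mulg1 mul1g.
Qed.

Lemma w0E : w r a 0 = pair_aut 1 (pair_aut (a r.-1) (a r.-1)).
Proof. by rewrite /= z_pair. Qed.

Lemma delta_z : delta (pair_aut (a r.-1) (a r.-1)) = dih_z.
Proof. by rewrite delta_pair parity_a ?r1_range // r2E // eqxx. Qed.

(** The parities involved vanish because diagonal pairs have parity zero at every depth. *)
Lemma delta_w i : delta (w r a i) = 1.
Proof.
case: i => [|i]; first by rewrite w0E delta_pair parity1 parity_diag.
rewrite delta_pair; suff -> : parity r.-2 (w r a i) = false by [].
case: i => [|i]; last by rewrite /= parity_diag.
by rewrite w0E; case: r.-2 => // j; rewrite parity_pair parity1 parity_diag.
Qed.

(** The first element is (1, z) with z in G and [delta] of z equal to [dih_z], the permitted central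
    defect; the later ones are diagonal without defect. *)
Lemma Norm_w i : N (w r a i).
Proof.
have [G1 GM GV] := GG; have GN := sub_Norm GG; have [N1 _ _] := NG.
elim: i => [|i IH].
  have Gz : G (pair_aut (a r.-1) (a r.-1)).
    rewrite -z_pair; apply: gen_sub_grpG; have [_ gM _] := gen_subgroup.
    have r1 : (1 <= r)%N by rewrite (leq_trans _ r3).
    have g1 : Gamma (a 1%N * a r) by apply: gM; apply: gen_mem; rewrite ?leqnn r1.
    exact: gM.
  rewrite w0E; apply: Norm_pair => //; first exact: GN.
    by rewrite mul1g; exact: GV.
  by exists true; rewrite delta_z delta1 dih_tau1 mul1g expg1.
apply: Norm_pair => //; first by rewrite mulgV.
by exists false; rewrite delta_w dih_tau1 mul1g expg0.
Qed.

Lemma kappa_w i j : kappa i (w r a j) = (i == j).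
Proof.
elim: i j => [|i IH] [|j].
- by rewrite w0E /kappa !coord_pair delta_z delta1.
- by rewrite /kappa !coord_pair !delta_w.
- by rewrite w0E /= coord_pair kappa1.
- by rewrite /= coord_pair IH.
Qed.

Lemma w_neq1 i : w r a i != 1.
Proof. by apply/eqP => wi1; have := kappa_w i i; rewrite wi1 kappa1 eqxx. Qed.

Lemma w_sqr i : w r a i ^+ 2 = 1.
Proof.
rewrite expgS expg1; elim: i => [|i IH].
  by rewrite w0E !pair_autM a_sqr ?r1_range // mulg1 !pair_aut1.
by rewrite /= pair_autM IH pair_aut1.
Qed.

Lemma cylinder_w i : cylinder 1 i (w r a i).
Proof.
elim: i => [|i IH]; first exact: cylinder0.
by apply: cylinderS => [|c] //=; rewrite coord_pair coord1; case: c.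
Qed.

Lemma w_cvg : w r a @ \oo --> (1 : treeAut).
Proof.
apply/cvg_cylinderP => m; exists m => n mn.
exact: cylinder_le mn (@cylinder_w n).
Qed.

Lemma phi_partialS k n :
  phi_partial r a k n.+1 = phi_partial r a k n * w r a n ^+ k n.
Proof. by rewrite /phi_partial big_nat_recr. Qed.

Lemma phi_partial_cylinder k m n :
  (m <= n)%N -> cylinder (phi_partial r a k m) m (phi_partial r a k n).
Proof.
elim: n => [|n IH]; first by rewrite leqn0 => /eqP->.
rewrite leq_eqVlt => /orP[/eqP->//|]; rewrite ltnS => mn.
rewrite phi_partialS -[phi_partial r a k m]mulg1; apply: cylinderM; first exact: IH.
by apply: cylinderX; exact: cylinder_le mn (@cylinder_w n).
Qed.

(** [limn] is meaningful only if a limit exists: completeness provides one, and the Hausdorff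
    property identifies it with [phi]. *)
Lemma phi_cylinder k m : cylinder (phi r a k) m (phi_partial r a k m).
Proof.
have [g gP] := treeAut_complete (@phi_partial_cylinder k).
suff -> : phi r a k = g by exact: gP.
apply: (cvg_lim treeAut_hausdorff); apply/cvg_cylinderP => n; exists n => i ni.
exact: cylinder_le ni (gP i).
Qed.

Lemma phi_cvg k : phi_partial r a k @ \oo --> phi r a k.
Proof.
apply/cvg_cylinderP => n; exists n => i ni.
exact: cylinder_le ni (@phi_cylinder k i).
Qed.

Lemma Norm_phi_partial k n : N (phi_partial r a k n).
Proof.
have [N1 NM _] := NG; elim: n => [|n IH]; first by rewrite /phi_partial big_geq.
rewrite phi_partialS; apply: (NM) => //.
elim: (nat_of_ord _) => [|m IHm]; rewrite ?expg0 // expgS.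
by apply: NM => //; exact: Norm_w.
Qed.

Lemma Norm_phi k : N (phi r a k).
Proof.
apply: Norm_cylinder => n; exists (phi_partial r a k n).
  exact: Norm_phi_partial.
exact: phi_cylinder.
Qed.

(** * Values of [kappa] on [phi], and the isomorphism *)

Lemma kappaX i g m : N g -> kappa i (g ^+ m) = odd m && kappa i g.
Proof.
move=> Ng; have [N1 NM _] := NG.
suff [] : N (g ^+ m) /\ kappa i (g ^+ m) = odd m && kappa i g by [].
elim: m => [|m [Ngm IH]]; first by rewrite expg0 kappa1.
rewrite expgS kappaM // IH; split; first exact: NM.
by rewrite /=; case: odd; case: kappa.
Qed.

Lemma kappa_phi_partial i k n :
  kappa i (phi_partial r a k n) = (i < n)%N && odd (k i).
Proof.
have [_ NM _] := NG.
elim: n => [|n IH]; first by rewrite /phi_partial big_geq // kappa1.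
(* The power is the quotient of two consecutive partial products. *)
have Nw : N (w r a n ^+ k n).
  have := Norm_phi_partial k n.+1; rewrite phi_partialS.
  have [_ _ NV] := NG; have /NV/NM H := Norm_phi_partial k n; move=> /H.
  by rewrite mulKg.
rewrite phi_partialS kappaM //; last exact: Norm_phi_partial.
rewrite IH kappaX; last exact: Norm_w.
rewrite kappa_w ltnS [(i <= n)%N]leq_eqVlt.
by have [->|_] := eqVneq i n; rewrite ?ltnn ?andbT ?andbF ?addbF.
Qed.

Lemma kappa_phi i k : kappa i (phi r a k) = odd (k i).
Proof.
(* By continuity of [kappa i], the partial product with i + r + 1 factors, which include that of
   [w i], gives the value. *)
rewrite -(cylinder_kappa (ltnSn (i + r)) (@phi_cylinder k _)) kappa_phi_partial.
by rewrite ltnS leq_addr.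
Qed.

Lemma kappa_grpGP g h : N g -> N h ->
  (forall i, kappa i g = kappa i h) <-> G (g^-1 * h).
Proof.
have [_ NM NV] := NG.
move=> Ng Nh; have NgV := NV _ Ng; split=> [gh|Ggh i].
  apply: kappa_ker => [|i]; first exact: NM.
  by rewrite kappaM // kappaV // gh addbb.
by have := kappa_grpG i Ggh; rewrite kappaM // kappaV //; do 2 case: kappa.
Qed.

Lemma phibar_bij : set_bij setT (lcos_quotient N G) (phibar r a).
Proof.
split.
- by move=> k _; exists (phi r a k) => //; exact: Norm_phi.
- move=> k l _ _ /(lcos_eqP _ _ GG)/kappa_grpGP kl.
  apply: funext => i; apply: odd_F2_inj.
  by rewrite -!kappa_phi kl //; exact: Norm_phi.
(* The preimage of the coset of [n] is the sequence of its defects. *)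
- move=> _ [n Nn <-]; exists (fun i => (kappa i n)%:R%R) => //.
  apply/(lcos_eqP _ _ GG)/kappa_grpGP => //; first exact: Norm_phi.
  by move=> i; rewrite kappa_phi; case: kappa.
Qed.

(** Both sides are cosets of elements of N with the same values of every [kappa i]. *)
Lemma phibarD (k l : nat -> 'F_2) :
  phibar r a (fun i => k i + l i)%R = set_mul (phibar r a k) (phibar r a l).
Proof.
have Nphi := Norm_phi; have [_ NM _] := NG.
rewrite /phibar lcos_mul //; last exact: Nphi.
apply/(lcos_eqP _ _ GG)/kappa_grpGP => //; first exact: NM.
by move=> i; rewrite kappaM // !kappa_phi odd_F2D.
Qed.

End PinkGroup.

Unset Implicit Arguments.

Theorem theorem3p7p18 (r : nat) (a : nat -> treeAut) :
  (3 <= r)%N -> recursion r a ->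
  let G := grpG r a in
  let N := Norm G in
  [/\ forall i, [/\ N (w r a i), w r a i != 1 & w r a i ^+ 2 = 1],
      w r a @ \oo --> (1 : treeAut),
      forall k : nat -> 'F_2,
        phi_partial r a k @ \oo --> phi r a k /\ N (phi r a k)
    & set_bij setT (lcos_quotient N G) (phibar r a) /\
      forall k l : nat -> 'F_2,
        phibar r a (fun i => k i + l i)%R =
        set_mul (phibar r a k) (phibar r a l)].
Proof.
move=> r3 recP G N; split.
- by move=> i; split; [exact: Norm_w|exact: w_neq1|exact: w_sqr].
- exact: w_cvg.
- by move=> k; split; [exact: phi_cvg|exact: Norm_phi].
- by split; [exact: phibar_bij|exact: phibarD].
Qed.
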